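(* Let $f\in\mathcal{A}_1$ be strongly spirallike, i.e. there exist $\lambda\in(-\pi/2,\pi/2)$ and $\alpha\in(0,1)$ such that $|\operatorname{Arg}(zf'(z)/f(z))-\lambda|<\pi\alpha/2$ for all $z\in\mathbb{D}$. Then $\operatorname{Log}(f(z)/z)$ is bounded on $\mathbb{D}$. In particular, $f$ is bounded on $\mathbb{D}$. *)

(* Defs.v *)
From Stdlib Require Import Reals.
Open Scope R_scope.

Definition Cplx : Type := (R * R)%type.
Definition Cre (z : Cplx) : R := fst z.
Definition Cim (z : Cplx) : R := snd z.
Definition C0 : Cplx := (0, 0).
Definition C1 : Cplx := (1, 0).
Definition Cadd (z w : Cplx) : Cplx := (fst z + fst w, snd z + snd w).
Definition Copp (z : Cplx) : Cplx := (- fst z, - snd z).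
Definition Csub (z w : Cplx) : Cplx := Cadd z (Copp w).
Definition Cmul (z w : Cplx) : Cplx :=
  (fst z * fst w - snd z * snd w, fst z * snd w + snd z * fst w).
Definition Cinv (z : Cplx) : Cplx :=
  (fst z / (fst z ^ 2 + snd z ^ 2), - snd z / (fst z ^ 2 + snd z ^ 2)).
Definition Cdiv (z w : Cplx) : Cplx := Cmul z (Cinv w).
Definition Cnorm (z : Cplx) : R := sqrt (fst z ^ 2 + snd z ^ 2).
Definition Cexp (z : Cplx) : Cplx := (exp (fst z) * cos (snd z), exp (fst z) * sin (snd z)).

(* principal argument Arg z in (-PI, PI]  (Arg 0 := 0) *)
Definition Arg (z : Cplx) : R :=
  let x := fst z in let y := snd z in
  if Rlt_dec 0 x then atan (y / x)
  else if Rlt_dec x 0 then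
    (if Rle_dec 0 y then atan (y / x) + PI else atan (y / x) - PI)
  else if Rlt_dec 0 y then PI / 2
  else if Rlt_dec y 0 then - (PI / 2)
  else 0.

Definition in_disc (z : Cplx) : Prop := Cnorm z < 1.

Definition has_cderiv (f : Cplx -> Cplx) (z l : Cplx) : Prop :=
  forall eps : R, eps > 0 -> exists delta : R, delta > 0 /\
    forall h : Cplx, h <> C0 -> Cnorm h < delta -> in_disc (Cadd z h) ->
      Cnorm (Csub (Cdiv (Csub (f (Cadd z h)) (f z)) h) l) < eps.

Definition ccontinuous_on_disc (g : Cplx -> Cplx) : Prop :=
  forall z : Cplx, in_disc z -> forall eps : R, eps > 0 -> exists delta : R, delta > 0 /\
    forall w : Cplx, in_disc w -> Cnorm (Csub w z) < delta -> Cnorm (Csub (g w) (g z)) < eps.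

Definition in_A1 (f f' : Cplx -> Cplx) : Prop :=
  (forall z : Cplx, in_disc z -> has_cderiv f z (f' z)) /\ f C0 = C0 /\ f' C0 = C1.

Definition strongly_spirallike (f f' : Cplx -> Cplx) (lambda alpha : R) : Prop :=
  forall z : Cplx, in_disc z -> z <> C0 ->
    f z <> C0 /\
    Rabs (Arg (Cdiv (Cmul z (f' z)) (f z)) - lambda) < PI * alpha / 2.

(* Main.v *)
From Stdlib Require Import Reals Ranalysis5 Lra Lia ClassicalEpsilon.
From Coquelicot Require Import Coquelicot.
Require Import Defs.
Open Scope R_scope.

(* In the coordinate [z = exp w], [Re w < 0], a continuous logarithm [F w] of [f (exp w)] has
   derivative [z f'(z) / f(z)], whose values lie in a convex sector of opening [PI alpha < PI].
   By the mean value theorem all slopes [(F b - F a) / (b - a)] lie in the closed sector. Fix a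
   line [Re w = s0] on which [F w - w] is bounded. For [b] to the right of that line, compare [F b]
   with the values of [F] at the two points of the line at heights [Im b - L] and [Im b + L]. For
   [L] large, the directions from these points to [b] differ by more than the opening of the
   sector, so the two resulting sectors that contain [F b] meet in a bounded set, uniformly
   in [b]. *)

(** * Complex exponential and logarithm *)

(* [Cplx] and the operations on it are convertible to Coquelicot's [C] and the operations of
   [C_scope], in which the lemmas are stated. *)

Lemma Cexp_plus (z w : C) : Cexp (z + w)%C = (Cexp z * Cexp w)%C.
Proof.
  unfold Cexp, Cplus, Cmult; cbn [fst snd].
  rewrite exp_plus, cos_plus, sin_plus. f_equal; ring.
Qed.

Lemma Cmod_Cexp (z : C) : Cmod (Cexp z) = exp (Re z).
Proof.
  unfold Cmod, Cexp, Re; cbn [fst snd]. rewrite <- (sqrt_pow2 (exp (fst z))) at 3.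
  - f_equal. pose proof (sin2_cos2 (snd z)) as Hpyth. unfold Rsqr in Hpyth.
    transitivity (exp (fst z) ^ 2 * (sin (snd z) * sin (snd z) + cos (snd z) * cos (snd z)));
      [ring | rewrite Hpyth; ring].
  - left; apply exp_pos.
Qed.

Lemma Cexp_neq_0 (z : C) : Cexp z <> RtoC 0.
Proof. apply Cmod_gt_0. rewrite Cmod_Cexp. apply exp_pos. Qed.

Lemma Cexp_minus (z w : C) : Cexp (z - w)%C = (Cexp z / Cexp w)%C.
Proof.
  assert (Hz : z = (z - w + w)%C) by ring.
  rewrite Hz at 2. rewrite Cexp_plus. unfold Complex.Cdiv.
  rewrite <- Cmult_assoc, Cinv_r, Cmult_1_r; [reflexivity | apply Cexp_neq_0].
Qed.

Lemma Cmod_le_Rabs_plus (z : C) : Cmod z <= Rabs (Re z) + Rabs (Im z).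
Proof.
  pose proof (Rabs_pos (Re z)). pose proof (Rabs_pos (Im z)).
  unfold Cmod. rewrite <- (sqrt_pow2 (Rabs (Re z) + Rabs (Im z))) by lra.
  apply sqrt_le_1_alt. rewrite <- (pow2_abs (fst z)), <- (pow2_abs (snd z)).
  unfold Re, Im in *. nra.
Qed.

Lemma polar_atan (x y : R) : 0 < x ->
  sqrt (x ^ 2 + y ^ 2) * cos (atan (y / x)) = x /\
  sqrt (x ^ 2 + y ^ 2) * sin (atan (y / x)) = y.
Proof.
  intros Hx.
  assert (Hfactor : sqrt (x ^ 2 + y ^ 2) = x * sqrt (1 + (y / x)²)).
  { rewrite <- (sqrt_pow2 x) at 2 by lra. rewrite <- sqrt_mult.
    - f_equal. unfold Rsqr. field. lra.
    - apply pow2_ge_0.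
    - pose proof (Rle_0_sqr (y / x)). lra. }
  assert (Hroot : sqrt (1 + (y / x)²) <> 0).
  { apply Rgt_not_eq, sqrt_lt_R0. pose proof (Rle_0_sqr (y / x)). lra. }
  rewrite Hfactor, cos_atan, sin_atan. split; field; lra.
Qed.

Definition Clog (z : C) : C := (ln (Cmod z), Arg z).

Lemma polar_Arg (z : C) : z = (Cmod z * cos (Arg z), Cmod z * sin (Arg z)).
Proof.
  destruct z as [x y]. unfold Arg, Cmod; cbn [fst snd].
  destruct (Rlt_dec 0 x) as [Hpos|Hnpos].
  { destruct (polar_atan x y Hpos) as [-> ->]. reflexivity. }
  destruct (Rlt_dec x 0) as [Hneg|Hnneg].
  - destruct (polar_atan (- x) (- y)) as [Hcos Hsin]; [lra|].
    replace (- y / - x) with (y / x) in Hcos, Hsin by (field; lra).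
    replace ((- x) ^ 2 + (- y) ^ 2) with (x ^ 2 + y ^ 2) in Hcos, Hsin by ring.
    destruct (Rle_dec 0 y).
    + rewrite neg_cos, neg_sin. f_equal; lra.
    + rewrite cos_minus, sin_minus, cos_PI, sin_PI. f_equal; lra.
  - replace x with 0 by lra.
    replace (sqrt (0 ^ 2 + y ^ 2)) with (Rabs y).
    2: { rewrite <- sqrt_Rsqr_abs. f_equal. unfold Rsqr. ring. }
    destruct (Rlt_dec 0 y); [|destruct (Rlt_dec y 0)].
    + rewrite Rabs_pos_eq, cos_PI2, sin_PI2 by lra. f_equal; ring.
    + rewrite Rabs_left, cos_neg, sin_neg, cos_PI2, sin_PI2 by lra. f_equal; ring.
    + replace y with 0 by lra. rewrite Rabs_R0. f_equal; ring.
Qed.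

Lemma Cexp_Clog (z : C) : z <> RtoC 0 -> Cexp (Clog z) = z.
Proof.
  intros Hz. unfold Cexp, Clog; cbn [fst snd].
  rewrite exp_ln by now apply Cmod_gt_0. symmetry. apply polar_Arg.
Qed.

Lemma Clog_1 : Clog (RtoC 1) = RtoC 0.
Proof.
  unfold Clog, Arg. rewrite Cmod_1, ln_1. cbn [fst snd RtoC].
  destruct (Rlt_dec 0 1); [|lra]. rewrite Rdiv_0_l, atan_0. reflexivity.
Qed.

Lemma Cmult_Cdiv_cancel (z w : C) : w <> RtoC 0 -> (w * (z / w))%C = z.
Proof. intros Hw. field. exact Hw. Qed.

Lemma Cdiv_Cmult_cancel (z w : C) : w <> RtoC 0 -> (w * z / w)%C = z.
Proof. intros Hw. field. exact Hw. Qed.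

Lemma Cdiv_neq_0 (z w : C) : z <> RtoC 0 -> w <> RtoC 0 -> (z / w)%C <> RtoC 0.
Proof.
  intros Hz Hw. apply Cmod_gt_0. rewrite Cmod_div by exact Hw.
  apply Rdiv_lt_0_compat; now apply Cmod_gt_0.
Qed.

Lemma Re_Cdiv_pos (z w : C) : Cmod (z - w) < Cmod w -> 0 < Re (z / w).
Proof.
  intros Hzw.
  assert (Hw : w <> RtoC 0).
  { apply Cmod_gt_0. pose proof (Cmod_ge_0 (z - w)). lra. }
  assert (Hdist : Cmod ((z - w) / w) < 1).
  { rewrite Cmod_div by exact Hw. apply Rlt_div_l; [now apply Cmod_gt_0 | lra]. }
  replace ((z - w) / w)%C with (z / w - 1)%C in Hdist by (field; exact Hw).
  pose proof (re_le_Cmod (z / w - 1)) as HRe. apply Rabs_le_between in HRe.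
  change (Re (z / w - 1)) with (Re (z / w) - 1) in HRe. lra.
Qed.

(** * Continuity of complex-valued maps *)

Lemma continuous_Cmod_iff {U : UniformSpace} (f : U -> C) (x : U) :
  continuous f x <-> forall eps : posreal, locally x (fun y => Cmod (f y - f x) < eps).
Proof. exact (filterlim_locally_ball_norm (U := C_NormedModule) f (f x)). Qed.

Lemma continuous_Cmod (z : C) : continuous Cmod z.
Proof. exact (filterlim_norm (V := C_NormedModule) z). Qed.

Lemma continuous_C_iff {U : UniformSpace} (f : U -> C) (x : U) :
  continuous f x <->
  continuous (fun y => Re (f y)) x /\ continuous (fun y => Im (f y)) x.
Proof.
  split.
  - intros Hf. destruct (f x) as [a b] eqn:Hfx.
    split; apply (continuous_comp f); auto; rewrite Hfx.
    + apply continuous_fst.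
    + apply continuous_snd.
  - intros [HRe HIm].
    apply (continuous_ext (fun y => (Re (f y), Im (f y)))).
    { intros y. symmetry. apply surjective_pairing. }
    apply (continuous_comp_2 (fun y => Re (f y)) (fun y => Im (f y)) pair); auto.
    apply (continuous_ext (fun p => p)); [apply surjective_pairing | apply continuous_id].
Qed.

Lemma continuous_Cmult {U : UniformSpace} (f g : U -> C) (x : U) :
  continuous f x -> continuous g x -> continuous (fun y => (f y * g y)%C) x.
Proof.
  intros [HfRe HfIm]%continuous_C_iff [HgRe HgIm]%continuous_C_iff.
  apply continuous_C_iff; split; cbn.
  - apply (continuous_minus (V := R_NormedModule)); now apply (continuous_mult (K := R_AbsRing)).
  - apply (continuous_plus (V := R_NormedModule)); now apply (continuous_mult (K := R_AbsRing)).
Qed.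

Lemma continuous_Cinv (z : C) : z <> RtoC 0 -> continuous Complex.Cinv z.
Proof.
  intros Hz.
  assert (Hid : continuous (fun w : C => w) z) by apply continuous_id.
  apply continuous_C_iff in Hid as [HRe HIm].
  assert (Hinv : continuous (fun w : C => / (Re w ^ 2 + Im w ^ 2)) z).
  { apply (continuous_ext (fun w => / (Cmod w * Cmod w))).
    { intros w. f_equal. rewrite <- Cmod2_alt. ring. }
    apply (continuous_comp (fun w => Cmod w * Cmod w)).
    - apply (continuous_mult (K := R_AbsRing)); apply continuous_Cmod.
    - apply continuous_Rinv. apply Cmod_gt_0 in Hz. nra. }
  apply continuous_C_iff; split; apply (continuous_mult (K := R_AbsRing)); auto.
  now apply (continuous_opp (V := R_NormedModule)).
Qed.

Lemma continuous_Clog (z : C) : 0 < Re z -> continuous Clog z.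
Proof.
  intros Hz.
  assert (Hid : continuous (fun w : C => w) z) by apply continuous_id.
  apply continuous_C_iff in Hid as [HRe HIm].
  apply continuous_C_iff; split.
  - apply (continuous_comp Cmod ln); [apply continuous_Cmod|].
    apply continuous_ln. pose proof (re_le_Cmod z). pose proof (Rle_abs (Re z)). lra.
  - apply (continuous_ext_loc _ (fun w => atan (Im w / Re w))).
    + assert (Hpos : locally z (fun w : C => 0 < Re w)).
      { apply (open_comp Re (fun x => 0 < x)); [| apply open_gt | exact Hz].
        intros [x y] _. apply continuous_fst. }
      revert Hpos. apply filter_imp. intros w Hw. cbn. unfold Arg.
      now destruct (Rlt_dec 0 (fst w)).
    + apply (continuous_comp (fun w => Im w / Re w)); [|apply continuous_atan].
      apply (continuous_mult (K := R_AbsRing)); [exact HIm|].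
      apply (continuous_comp Re Rinv); [exact HRe | apply continuous_Rinv; lra].
Qed.

(** * Continuous logarithms on star-shaped sets *)

Lemma continuous_cos_eq_1_nonpos (p : R -> R) (a b : R) :
  a < b -> (forall t, a <= t <= b -> continuous p t) ->
  (forall t, a <= t <= b -> cos (p t) = 1) -> p a = 0 -> p b <= 0.
Proof.
  intros Hab Hp Hcos Ha. apply Rnot_lt_le. intros Hb. pose proof PI_RGT_0 as Hpi.
  set (y := Rmin (p b) PI / 2).
  assert (Hy : 0 < y <= PI / 2 /\ y < p b).
  { unfold y. pose proof (Rmin_l (p b) PI). pose proof (Rmin_r (p b) PI).
    pose proof (Rmin_glb_lt (p b) PI 0 Hb Hpi). lra. }
  destruct (IVT_interv (fun t => p t - y) a b) as [t [Ht Hpt]]; try lra.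
  - intros t Ht. apply continuity_pt_filterlim.
    apply (continuous_minus (V := R_NormedModule)); [now apply Hp | apply continuous_const].
  - specialize (Hcos t Ht). replace (p t) with y in Hcos by lra.
    pose proof (cos_decreasing_1 0 y) as Hdecr. rewrite cos_0 in Hdecr. lra.
Qed.

Lemma continuous_log_unique (g h : R -> C) (a b : R) :
  a < b -> (forall t, a <= t <= b -> continuous g t) ->
  (forall t, a <= t <= b -> continuous h t) ->
  (forall t, a <= t <= b -> Cexp (g t) = Cexp (h t)) -> g a = h a -> g b = h b.
Proof.
  intros Hab Hg Hh Hexp Ha.
  assert (Hquot : forall t, a <= t <= b -> Cexp (g t - h t)%C = RtoC 1).
  { intros t Ht. rewrite Cexp_minus, Hexp by exact Ht. apply Cinv_r, Cexp_neq_0. }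
  assert (HRe : Re (g b) = Re (h b)).
  { assert (Hmod : exp (Re (g b)) = exp (Re (h b))).
    { rewrite <- !Cmod_Cexp, Hexp by lra. reflexivity. }
    now apply exp_inv. }
  assert (Hcos : forall t, a <= t <= b -> cos (Im (g t) - Im (h t)) = 1).
  { intros t Ht. specialize (Hquot t Ht).
    pose proof (f_equal Cmod Hquot) as Hmod. rewrite Cmod_Cexp, Cmod_1 in Hmod.
    apply (f_equal Re) in Hquot. unfold Cexp, Re in *. cbn [fst] in Hquot.
    rewrite Hmod, Rmult_1_l in Hquot. exact Hquot. }
  assert (HIm : Im (g b) = Im (h b)).
  { assert (Hcont : forall f : R -> C, (forall t, a <= t <= b -> continuous f t) ->
      forall t, a <= t <= b -> continuous (fun s => Im (f s)) t).
    { intros f Hf t Ht. now apply continuous_C_iff, Hf. }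
    apply Rle_antisym; apply Rminus_le.
    - apply (continuous_cos_eq_1_nonpos (fun t => Im (g t) - Im (h t)) a b Hab); [|exact Hcos|].
      + intros t Ht. apply (continuous_minus (V := R_NormedModule)); now apply Hcont.
      + rewrite Ha. ring.
    - apply (continuous_cos_eq_1_nonpos (fun t => Im (h t) - Im (g t)) a b Hab).
      + intros t Ht. apply (continuous_minus (V := R_NormedModule)); now apply Hcont.
      + intros t Ht. rewrite <- cos_neg, Ropp_minus_distr. now apply Hcos.
      + rewrite Ha. ring. }
  now apply injective_projections.
Qed.

Section StarShaped.

Variables (E : NormedModule R_AbsRing) (D : E -> Prop) (k : E -> C).
Hypothesis open_D : open D.
Hypothesis zero_in_D : D zero.
Hypothesis star_D : forall (t : R) (z : E), 0 <= t <= 1 -> D z -> D (scal t z).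
Hypothesis continuous_k : forall z, D z -> continuous k z.
Hypothesis k_neq_0 : forall z, D z -> k z <> RtoC 0.

Lemma k_ray_neq_0 (t : R) (z : E) : 0 <= t <= 1 -> D z -> k (scal t z) <> RtoC 0.
Proof. intros Ht Hz. now apply k_neq_0, star_D. Qed.

(* Two values of [k] on the segment from [0] to [z], at parameters at most [h] apart, have
   their quotient in the disc [|q - 1| < 1], where [Clog] is continuous. *)
Definition radially_fine (h : R) (z : E) : Prop :=
  forall s t, 0 <= s <= 1 -> 0 <= t <= 1 -> Rabs (s - t) <= h ->
    Cmod (k (scal s z) - k (scal t z)) < Cmod (k (scal t z)).

Lemma radially_fine_scal (h t : R) (z : E) :
  0 <= t <= 1 -> radially_fine h z -> radially_fine h (scal t z).
Proof.
  intros Ht Hfine s s' Hs Hs' Hss'. rewrite !scal_assoc. cbn.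
  apply Hfine; try nra.
  replace (s * t - s' * t) with ((s - s') * t) by ring.
  rewrite Rabs_mult, (Rabs_pos_eq t) by lra. pose proof (Rabs_pos (s - s')). nra.
Qed.

Lemma continuous_ray_near (z : E) (t : R) :
  D z -> 0 <= t <= 1 ->
  exists delta : posreal, forall s w, Rabs (s - t) < 2 * delta -> ball z delta w ->
    Cmod (k (scal s w) - k (scal t z)) < Cmod (k (scal t z)) / 3.
Proof.
  intros Hz Ht.
  assert (Hcont : continuous (fun p : R * E => k (scal (fst p) (snd p))) (t, z)).
  { apply (continuous_comp (fun p : R * E => scal (fst p) (snd p)) k).
    - apply (continuous_scal (K := R_AbsRing)); [apply continuous_fst | apply continuous_snd].
    - now apply continuous_k, star_D. }
  assert (Heps : 0 < Cmod (k (scal t z)) / 3).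
  { pose proof (proj1 (Cmod_gt_0 _) (k_ray_neq_0 t z Ht Hz)). lra. }
  destruct (proj1 (continuous_Cmod_iff _ _) Hcont (mkposreal _ Heps)) as [d Hd].
  exists (pos_div_2 d). intros s w Hs Hw. apply (Hd (s, w)). cbn in Hs, Hw. split; cbn.
  - change (Rabs (s - t) < d). lra.
  - apply (ball_le _ (d / 2)); [pose proof (cond_pos d); lra | exact Hw].
Qed.

Lemma locally_radially_fine (z : E) :
  D z -> exists n : nat, locally z (radially_fine (/ INR (S n))).
Proof.
  intros Hz.
  assert (Hnear : forall t, exists delta : posreal, 0 <= t <= 1 ->
    forall s w, Rabs (s - t) < 2 * delta -> ball z delta w ->
      Cmod (k (scal s w) - k (scal t z)) < Cmod (k (scal t z)) / 3).
  { intros t. destruct (excluded_middle_informative (0 <= t <= 1)) as [Ht|Ht].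
    - destruct (continuous_ray_near z t Hz Ht) as [delta Hdelta]. now exists delta.
    - exists (mkposreal 1 Rlt_0_1). tauto. }
  apply choice in Hnear as [delta Hdelta].
  destruct (compactness_value_1d 0 1 delta) as [d Hd].
  destruct (archimed_cor1 d (cond_pos d)) as [[|n] [Hn Hn0]]; [lia|].
  exists n, d. intros w Hw s t Hs Ht Hst. apply NNPP. intros Hnot.
  apply (Hd t Ht). intros [u [Hu [Htu Hdu]]]. apply Hnot.
  assert (Hw' : ball z (delta u) w) by now apply (ball_le _ d).
  assert (Hsu : Rabs (s - u) < 2 * delta u).
  { replace (s - u) with ((s - t) + (t - u)) by ring.
    pose proof (Rabs_triang (s - t) (t - u)). lra. }
  pose proof (Hdelta u Hu s w Hsu Hw') as Hks.
  pose proof (Hdelta u Hu t w ltac:(pose proof (cond_pos (delta u)); lra) Hw') as Hkt.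
  set (a := k (scal s w)) in *. set (b := k (scal t w)) in *. set (c := k (scal u z)) in *.
  assert (Hac : Cmod (a - b) <= Cmod (a - c) + Cmod (b - c)).
  { rewrite <- (Cmod_opp (b - c)). replace (a - b)%C with ((a - c) + - (b - c))%C by ring.
    apply Cmod_triangle. }
  assert (Hcb : Cmod c <= Cmod b + Cmod (b - c)).
  { rewrite <- (Cmod_opp (b - c)). replace c with (b + - (b - c))%C at 1 by ring.
    apply Cmod_triangle. }
  lra.
Qed.

Fixpoint radial_log (h : R) (j : nat) (z : E) : C :=
  match j with
  | O => Clog (k zero)
  | S i =>
      (radial_log h i z + Clog (k (scal (INR (S i) * h)%R z) / k (scal (INR i * h)%R z)))%C
  end.

Lemma radial_log_zero (h : R) (j : nat) : radial_log h j zero = Clog (k zero).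
Proof.
  induction j as [|i IH]; [reflexivity|]. cbn [radial_log].
  assert (Hscal : forall t : R, scal t zero = zero :> E) by exact (scal_zero_r (V := E)).
  rewrite !Hscal, IH.
  replace (k zero / k zero)%C with (RtoC 1) by (symmetry; apply Cinv_r, k_neq_0, zero_in_D).
  rewrite Clog_1. apply Cplus_0_r.
Qed.

Lemma Cexp_radial_log (h : R) (j : nat) (z : E) :
  D z -> 0 <= h -> INR j * h <= 1 ->
  Cexp (radial_log h j z) = k (scal (INR j * h) z).
Proof.
  intros Hz Hh. induction j as [|i IH]; intros Hj; cbn [radial_log].
  - cbn [INR]. rewrite Rmult_0_l.
    replace (scal 0 z) with (zero : E) by (symmetry; exact (scal_zero_l z)).
    apply Cexp_Clog, k_neq_0, zero_in_D.
  - pose proof (pos_INR i) as Hi. rewrite S_INR in *.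
    rewrite Cexp_plus, IH by nra. rewrite Cexp_Clog.
    + apply Cmult_Cdiv_cancel, k_ray_neq_0; [nra | exact Hz].
    + apply Cdiv_neq_0; apply k_ray_neq_0; (nra || exact Hz).
Qed.

Lemma continuous_radial_log (h : R) (j : nat) (z : E) :
  D z -> 0 <= h -> radially_fine h z -> INR j * h <= 1 -> continuous (radial_log h j) z.
Proof.
  intros Hz Hh Hfine. induction j as [|i IH]; intros Hj; cbn [radial_log].
  - apply continuous_const.
  - assert (Hi : 0 <= INR i * h) by (pose proof (pos_INR i); nra).
    assert (HSi : INR (S i) * h = INR i * h + h) by (rewrite S_INR; ring).
    assert (Hray : forall t, 0 <= t <= 1 -> continuous (fun w : E => k (scal t w)) z).
    { intros t Ht. apply (continuous_comp (fun w : E => scal t w) k).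
      - apply (continuous_scal_r t (fun w : E => w)), continuous_id.
      - now apply continuous_k, star_D. }
    apply (continuous_plus (V := C_NormedModule)); [apply IH; lra|].
    apply (continuous_comp
      (fun w : E => (k (scal (INR (S i) * h)%R w) / k (scal (INR i * h)%R w))%C) Clog).
    + apply continuous_Cmult; [apply Hray; lra|].
      apply (continuous_comp (fun w : E => k (scal (INR i * h) w))); [apply Hray; lra|].
      apply continuous_Cinv, k_ray_neq_0; [lra | exact Hz].
    + apply continuous_Clog, Re_Cdiv_pos, Hfine; [lra | lra |].
      replace (INR (S i) * h - INR i * h) with h by lra. rewrite Rabs_pos_eq; lra.
Qed.

Lemma radial_log_independent (h h' : R) (j j' : nat) (z : E) :
  D z -> 0 <= h -> 0 <= h' -> INR j * h = 1 -> INR j' * h' = 1 ->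
  radially_fine h z -> radially_fine h' z -> radial_log h j z = radial_log h' j' z.
Proof.
  intros Hz Hh Hh' Hj Hj' Hfine Hfine'.
  assert (Hray : forall d i, 0 <= d -> INR i * d = 1 -> radially_fine d z ->
    forall t, 0 <= t <= 1 -> continuous (fun s : R => radial_log d i (scal s z)) t).
  { intros d i Hd Hi Hdz t Ht. apply (continuous_comp (fun s : R => scal s z) (radial_log d i)).
    - apply (continuous_scal_l (fun s : R => s) z), continuous_id.
    - apply continuous_radial_log; [now apply star_D | exact Hd | | lra].
      now apply radially_fine_scal. }
  pose proof (continuous_log_unique (fun t => radial_log h j (scal t z))
    (fun t => radial_log h' j' (scal t z)) 0 1 Rlt_0_1 (Hray h j Hh Hj Hfine)
    (Hray h' j' Hh' Hj' Hfine')) as Huniq.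
  assert (Hone : scal 1 z = z) by exact (scal_one z). cbv beta in Huniq.
  rewrite Hone in Huniq. apply Huniq.
  - intros t Ht. rewrite !Cexp_radial_log by (auto; lra). now rewrite Hj, Hj'.
  - replace (scal 0 z) with (zero : E) by (symmetry; exact (scal_zero_l z)).
    now rewrite !radial_log_zero.
Qed.

Lemma continuous_log_star_shaped :
  exists g : E -> C, g zero = Clog (k zero) /\
    forall z, D z -> continuous g z /\ Cexp (g z) = k z.
Proof.
  assert (Hfine : forall z, exists n, D z -> locally z (radially_fine (/ INR (S n)))).
  { intros z. destruct (excluded_middle_informative (D z)) as [Hz|Hz].
    - destruct (locally_radially_fine z Hz) as [n Hn]. now exists n.
    - exists O. tauto. }
  apply choice in Hfine as [n Hn].
  assert (Hstep : forall z, 0 <= / INR (S (n z)) /\ INR (S (n z)) * / INR (S (n z)) = 1).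
  { intros z. pose proof (lt_0_INR (S (n z)) (Nat.lt_0_succ _)) as Hpos. split.
    - left. now apply Rinv_0_lt_compat.
    - apply Rinv_r. lra. }
  exists (fun z => radial_log (/ INR (S (n z))) (S (n z)) z). split.
  { apply radial_log_zero. }
  intros z Hz. destruct (Hstep z) as [Hh Hsum].
  pose proof (locally_singleton _ _ (Hn z Hz)) as Hfine. split.
  - apply (continuous_ext_loc _ (radial_log (/ INR (S (n z))) (S (n z)))).
    + generalize (filter_and _ _ (open_D z Hz) (Hn z Hz)). apply filter_imp.
      intros w [Hw Hfw]. destruct (Hstep w) as [Hhw Hsumw].
      apply radial_log_independent; auto. exact (locally_singleton _ _ (Hn w Hw)).
    + apply continuous_radial_log; auto; lra.
  - rewrite Cexp_radial_log, Hsum by (auto; lra).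
    f_equal. exact (scal_one z).
Qed.

End StarShaped.

(** * Complex derivatives *)

Lemma is_derive_C_iff (f : C -> C) (z l : C) :
  is_derive f z l <-> forall eps : posreal,
    locally z (fun w : C => Cmod (f w - f z - (w - z) * l) <= eps * Cmod (w - z)).
Proof.
  split.
  - intros [_ Hf] eps. apply locally_C. apply (Hf z (fun P HP => HP) eps).
  - intros Hf. split; [apply is_linear_scal_l|].
    intros x Hx eps.
    apply (is_filter_lim_locally_unique (V := AbsRing_NormedModule C_AbsRing)) in Hx as <-.
    apply locally_C, Hf.
Qed.

Lemma is_derive_Cauchy_Riemann (f : C -> C) (z l : C) :
  differentiable_pt_lim (fun x y => Re (f (x, y))) (Re z) (Im z) (Re l) (- Im l) ->
  differentiable_pt_lim (fun x y => Im (f (x, y))) (Re z) (Im z) (Im l) (Re l) ->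
  is_derive f z l.
Proof.
  intros DRe DIm. apply is_derive_C_iff. intros eps.
  destruct (DRe (pos_div_2 eps)) as [dRe HRe]. destruct (DIm (pos_div_2 eps)) as [dIm HIm].
  exists (mkposreal _ (Rmin_stable_in_posreal dRe dIm)). intros [x y] [Hx Hy].
  change (Rabs (x - Re z) < Rmin dRe dIm) in Hx.
  change (Rabs (y - Im z) < Rmin dRe dIm) in Hy.
  pose proof (Rmin_l dRe dIm). pose proof (Rmin_r dRe dIm).
  specialize (HRe x y ltac:(lra) ltac:(lra)). specialize (HIm x y ltac:(lra) ltac:(lra)).
  rewrite <- surjective_pairing in HRe, HIm. cbn [pos pos_div_2] in HRe, HIm.
  assert (Hmax : Rmax (Rabs (x - Re z)) (Rabs (y - Im z)) <= Cmod ((x, y) - z)).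
  { exact (Rmax_Cmod ((x, y) - z)%C). }
  pose proof (cond_pos eps) as Heps.
  pose proof (Rmult_le_compat_l (eps / 2) _ _ ltac:(lra) Hmax) as Hscaled.
  eapply Rle_trans; [apply Cmod_le_Rabs_plus|].
  set (remainder := (f (x, y) - f z - ((x, y) - z) * l)%C).
  assert (Rabs (Re remainder) <= eps / 2 * Cmod ((x, y) - z)).
  { eapply Rle_trans; [|exact (Rle_trans _ _ _ HRe Hscaled)]. right.
    unfold remainder, Re, Im; cbn. f_equal. ring. }
  assert (Rabs (Im remainder) <= eps / 2 * Cmod ((x, y) - z)).
  { eapply Rle_trans; [|exact (Rle_trans _ _ _ HIm Hscaled)]. right.
    unfold remainder, Re, Im; cbn. f_equal. ring. }
  lra.
Qed.

Lemma differentiable_pt_lim_mult_1d (f g : R -> R) (x y f' g' : R) :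
  derivable_pt_lim f x f' -> derivable_pt_lim g y g' ->
  differentiable_pt_lim (fun a b => f a * g b) x y (f' * g y) (f x * g').
Proof.
  intros Df Dg. apply filterdiff_differentiable_pt_lim.
  assert (Hf : filterdiff (fun u : R * R => f (fst u)) (locally (x, y)) (fun u => fst u * f')).
  { apply (filterdiff_comp' (U := prod_NormedModule _ R_NormedModule R_NormedModule)
        fst f (x, y) fst (fun t => t * f')); [apply filterdiff_linear, is_linear_fst|].
    exact (proj2 (is_derive_Reals f x f') Df). }
  assert (Hg : filterdiff (fun u : R * R => g (snd u)) (locally (x, y)) (fun u => snd u * g')).
  { apply (filterdiff_comp' (U := prod_NormedModule _ R_NormedModule R_NormedModule)
        snd g (x, y) snd (fun t => t * g')); [apply filterdiff_linear, is_linear_snd|].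
    exact (proj2 (is_derive_Reals g y g') Dg). }
  eapply filterdiff_ext_lin.
  - exact (filterdiff_mult_fct _ _ _ _ _ Rmult_comm Hf Hg).
  - intros u. cbn. unfold plus, mult; cbn. ring.
Qed.

Lemma is_derive_Cexp (z : C) : is_derive (Cexp : C -> C) z (Cexp z).
Proof.
  assert (Dexp : derivable_pt_lim exp (Re z) (exp (Re z))) by apply derivable_pt_lim_exp.
  apply is_derive_Cauchy_Riemann.
  - replace (- Im (Cexp z)) with (exp (Re z) * - sin (Im z))
      by (unfold Re, Im, Cexp; cbn [fst snd]; ring).
    exact (differentiable_pt_lim_mult_1d _ _ _ _ _ _ Dexp (derivable_pt_lim_cos (Im z))).
  - exact (differentiable_pt_lim_mult_1d _ _ _ _ _ _ Dexp (derivable_pt_lim_sin (Im z))).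
Qed.

Lemma is_derive_continuous_C (f : C -> C) (z l : C) : is_derive f z l -> continuous f z.
Proof.
  intros Hf P HP. apply locally_C.
  refine (ex_derive_continuous f z _ P HP). now exists l.
Qed.

Lemma continuous_Cexp (z : C) : continuous (Cexp : C -> C) z.
Proof. apply (is_derive_continuous_C _ _ _ (is_derive_Cexp z)). Qed.

Lemma is_derive_comp_C (f g : C -> C) (z f' g' : C) :
  is_derive f (g z) f' -> is_derive g z g' -> is_derive (fun w => f (g w)) z (f' * g')%C.
Proof.
  intros Hf Hg. rewrite Cmult_comm. apply (is_derive_comp f g z f' g' Hf).
  split; [apply is_linear_scal_l | exact (proj2 Hg)].
Qed.

Lemma is_derive_affine (a d z : C) : is_derive (fun w : C => (a + w * d)%C) z d.
Proof.
  apply is_derive_C_iff. intros eps. apply filter_forall. intros w.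
  replace (a + w * d - (a + z * d) - (w - z) * d)%C with (RtoC 0) by ring.
  rewrite Cmod_0. apply Rmult_le_pos; [left; apply cond_pos | apply Cmod_ge_0].
Qed.

Lemma is_derive_Re (f : C -> C) (t : R) (l : C) :
  is_derive f (RtoC t) l -> is_derive (fun s : R => Re (f (RtoC s))) t (Re l).
Proof.
  intros Hf. rewrite is_derive_C_iff in Hf.
  split; [apply is_linear_scal_l|].
  intros x Hx eps. apply (is_filter_lim_locally_unique (V := R_NormedModule)) in Hx as <-.
  destruct (Hf eps) as [d Hd]. exists d. intros s Hs.
  assert (Hball : ball (RtoC t : C_UniformSpace) d (RtoC s)).
  { split; [exact Hs | apply ball_center]. }
  specialize (Hd _ Hball). rewrite <- RtoC_minus, Cmod_R in Hd.
  eapply Rle_trans; [|exact Hd]. eapply Rle_trans; [|apply re_le_Cmod].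
  right. apply (f_equal Rabs). cbn. unfold Re. ring.
Qed.

Section DerivativeOfLift.

Variables (p g h : C -> C) (z m l : C).
Hypothesis m_neq_0 : m <> RtoC 0.
Hypothesis derive_p : is_derive p (g z) m.
Hypothesis derive_h : is_derive h z l.
Hypothesis continuous_g : continuous g z.
Hypothesis lift : locally z (fun w : C => p (g w) = h w).

Lemma lift_increment (eps : posreal) :
  locally z (fun w : C => Cmod (h w - h z - (g w - g z) * m) <= eps * Cmod (g w - g z)).
Proof.
  pose proof (continuous_g _ (proj1 (is_derive_C_iff p (g z) m) derive_p eps)) as Hp.
  generalize (filter_and _ _ lift Hp). apply filter_imp. intros w [<- Hw].
  now rewrite <- (locally_singleton _ _ lift).
Qed.

Lemma lift_locally_Lipschitz :
  locally z (fun w : C => Cmod (g w - g z) <= 2 * (Cmod l + 1) / Cmod m * Cmod (w - z)).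
Proof.
  pose proof (proj1 (Cmod_gt_0 m) m_neq_0) as Hm.
  generalize (filter_and _ _ (lift_increment (pos_div_2 (mkposreal _ Hm)))
    (proj1 (is_derive_C_iff h z l) derive_h (mkposreal 1 Rlt_0_1))).
  apply filter_imp. cbn [pos pos_div_2]. intros w [Hg Hh].
  set (dg := (g w - g z)%C) in *. set (dh := (h w - h z)%C) in *. set (dz := (w - z)%C) in *.
  assert (Hdg : Cmod dg * Cmod m <= Cmod dh + Cmod (dh - dg * m)).
  { rewrite <- Cmod_mult, <- (Cmod_opp (dh - dg * m)).
    replace (dg * m)%C with (dh + - (dh - dg * m))%C at 1 by ring. apply Cmod_triangle. }
  assert (Hdh : Cmod dh <= Cmod dz * Cmod l + Cmod (dh - dz * l)).
  { rewrite <- Cmod_mult. replace dh with (dz * l + (dh - dz * l))%C at 1 by ring.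
    apply Cmod_triangle. }
  apply Rmult_le_reg_r with (Cmod m); [exact Hm|].
  replace (2 * (Cmod l + 1) / Cmod m * Cmod dz * Cmod m) with (2 * (Cmod l + 1) * Cmod dz)
    by (field; lra).
  lra.
Qed.

Lemma is_derive_lift : is_derive g z (l / m)%C.
Proof.
  pose proof (proj1 (Cmod_gt_0 m) m_neq_0) as Hm.
  apply is_derive_C_iff. intros eps.
  set (K := 2 * (Cmod l + 1) / Cmod m).
  assert (HK : 0 < K) by (pose proof (Cmod_ge_0 l); apply Rdiv_lt_0_compat; lra).
  assert (Heps : 0 < eps * Cmod m / 2).
  { apply Rdiv_lt_0_compat; [apply Rmult_lt_0_compat; [apply cond_pos | exact Hm] | lra]. }
  generalize (filter_and _ _ lift_locally_Lipschitz (filter_and _ _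
    (lift_increment (mkposreal _ (Rdiv_lt_0_compat _ _ Heps HK)))
    (proj1 (is_derive_C_iff h z l) derive_h (mkposreal _ Heps)))).
  apply filter_imp. cbn [pos]. fold K. intros w [HLip [Hg Hh]].
  set (dg := (g w - g z)%C) in *. set (dh := (h w - h z)%C) in *. set (dz := (w - z)%C) in *.
  assert (Hsplit : Cmod (dg - dz * (l / m)) * Cmod m <= Cmod (dh - dz * l) + Cmod (dh - dg * m)).
  { rewrite <- Cmod_mult, <- (Cmod_opp (dh - dg * m)).
    replace ((dg - dz * (l / m)) * m)%C with ((dh - dz * l) + - (dh - dg * m))%C
      by (field; exact m_neq_0).
    apply Cmod_triangle. }
  assert (Hdg : eps * Cmod m / 2 / K * Cmod dg <= eps * Cmod m / 2 * Cmod dz).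
  { replace (eps * Cmod m / 2 * Cmod dz) with (eps * Cmod m / 2 / K * (K * Cmod dz))
      by (field; lra).
    apply Rmult_le_compat_l; [left; now apply Rdiv_lt_0_compat | exact HLip]. }
  apply Rmult_le_reg_r with (Cmod m); [exact Hm | lra].
Qed.

End DerivativeOfLift.

Lemma is_derive_log (g h : C -> C) (z l : C) :
  continuous g z -> is_derive h z l -> locally z (fun w : C => Cexp (g w) = h w) ->
  is_derive g z (l / h z)%C.
Proof.
  intros Hg Hh Hexp. rewrite <- (locally_singleton _ _ Hexp).
  apply (is_derive_lift Cexp g h); auto.
  - apply Cexp_neq_0.
  - apply is_derive_Cexp.
Qed.

(** * Sectors and mean slopes *)

Definition sector (T : R) (z : C) : Prop := Rabs (Im z) <= T * Re z.

Lemma sector_iff (T : R) (z : C) :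
  sector T z <-> 0 <= Re ((T, 1) * z) /\ 0 <= Re ((T, -1)%R * z).
Proof.
  unfold sector, Re, Im; cbn. rewrite Rabs_le_between. split; [intros | intros []]; lra.
Qed.

Lemma sector_Re_ge_0 (T : R) (z : C) : 0 < T -> sector T z -> 0 <= Re z.
Proof. unfold sector. intros HT Hz. pose proof (Rabs_pos (Im z)). nra. Qed.

Lemma sector_Cmod (T : R) (z : C) : 0 < T -> sector T z -> Cmod z <= (1 + T) * Re z.
Proof.
  intros HT Hz. pose proof (sector_Re_ge_0 T z HT Hz) as HRe.
  pose proof (Cmod_le_Rabs_plus z) as Hmod. rewrite Rabs_pos_eq in Hmod by exact HRe.
  unfold sector in Hz. lra.
Qed.

Lemma sector_tan_Arg (z : C) (lambda beta : R) :
  0 < beta < PI / 2 -> Rabs (Arg z - lambda) < beta ->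
  sector (tan beta) (Cexp (0, - lambda)%R * z)%C.
Proof.
  intros Hbeta HArg. apply Rabs_def2 in HArg. set (tau := Arg z - lambda) in *.
  assert (Hrot : (Cexp (0, - lambda)%R * z)%C = (Cmod z * cos tau, Cmod z * sin tau)).
  { rewrite (polar_Arg z) at 1. unfold Cexp, Cmult, tau; cbn [fst snd].
    rewrite exp_0, cos_neg, sin_neg, cos_minus, sin_minus. f_equal; ring. }
  assert (Hcos : 0 < cos beta) by (apply cos_gt_0; lra).
  assert (Hminus : 0 < sin (beta - tau)) by (apply sin_gt_0; lra).
  assert (Hplus : 0 < sin (beta + tau)) by (apply sin_gt_0; lra).
  rewrite sin_minus in Hminus. rewrite sin_plus in Hplus.
  assert (Htan : Rabs (sin tau) <= tan beta * cos tau).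
  { replace (tan beta * cos tau) with (sin beta * cos tau / cos beta)
      by (unfold tan; field; lra).
    apply Rle_div_r; [exact Hcos|].
    rewrite <- (Rabs_pos_eq (cos beta)) by lra. rewrite <- Rabs_mult. apply Rabs_le. lra. }
  rewrite Hrot. unfold sector; cbn. rewrite Rabs_mult, Rabs_pos_eq by apply Cmod_ge_0.
  pose proof (Rmult_le_compat_l _ _ _ (Cmod_ge_0 z) Htan). lra.
Qed.

Section Segment.

Variables (F F' : C -> C) (a b : C).
Hypothesis derive_F : forall t, 0 <= t <= 1 ->
  is_derive F (a + RtoC t * (b - a))%C (F' (a + RtoC t * (b - a))%C).
Hypothesis a_neq_b : a <> b.

Lemma Re_slope_ge_0 (c : C) :
  (forall t, 0 <= t <= 1 -> 0 <= Re (c * F' (a + RtoC t * (b - a)))) ->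
  0 <= Re (c * ((F b - F a) / (b - a))).
Proof.
  intros Hc. set (d := (b - a)%C) in *.
  assert (Hd : d <> RtoC 0) by (apply Cminus_eq_contra; congruence).
  set (phi := fun t : R => Re (0 + F (a + RtoC t * d) * (c / d))).
  assert (Hphi : forall t, 0 <= t <= 1 -> is_derive phi t (Re (c * F' (a + RtoC t * d)))).
  { intros t Ht. apply (is_derive_Re (fun w => 0 + F (a + w * d) * (c / d)))%C.
    replace (c * F' (a + RtoC t * d))%C with (c / d * (F' (a + RtoC t * d) * d))%C
      by (field; exact Hd).
    apply (is_derive_comp_C (fun w => 0 + w * (c / d))%C); [apply is_derive_affine|].
    apply (is_derive_comp_C F); [now apply derive_F | apply is_derive_affine]. }
  destruct (MVT_gen phi 0 1 (fun t => Re (c * F' (a + RtoC t * d)))) as [t [Ht Hincr]];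
    rewrite ?Rmin_left, ?Rmax_right in * by lra.
  - intros t Ht. apply Hphi. lra.
  - intros t Ht. apply continuity_pt_filterlim.
    apply (ex_derive_continuous phi t). eexists. now apply Hphi.
  - replace (Re (c * ((F b - F a) / d))) with (phi 1 - phi 0).
    + specialize (Hc t Ht). lra.
    + change (phi 1 - phi 0) with
        (Re ((0 + F (a + RtoC 1 * d) * (c / d)) - (0 + F (a + RtoC 0 * d) * (c / d)))).
      replace (a + RtoC 1 * d)%C with b by (unfold d; ring).
      replace (a + RtoC 0 * d)%C with a by ring. f_equal. field. exact Hd.
Qed.

Lemma sector_slope (T : R) (c : C) :
  (forall t, 0 <= t <= 1 -> sector T (c * F' (a + RtoC t * (b - a)))%C) ->
  sector T (c * ((F b - F a) / (b - a)))%C.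
Proof.
  intros Hsector. apply sector_iff; split; rewrite Cmult_assoc; apply Re_slope_ge_0;
    intros t Ht; rewrite <- Cmult_assoc; now apply sector_iff, Hsector.
Qed.

End Segment.

(* The condition on [L] makes the directions [d + i L] and [d - i L] differ by more than the
   opening of the sector. *)
Lemma sector_pair_bound (T d L : R) (u v : C) :
  0 < T -> 0 <= d -> T * d + 1 <= L -> sector T u -> sector T v ->
  Re u <= Cmod ((d, L) * u - (d, - L)%R * v).
Proof.
  intros HT Hd HL Hu Hv.
  pose proof (sector_Re_ge_0 T u HT Hu). pose proof (sector_Re_ge_0 T v HT Hv).
  unfold sector in Hu, Hv. apply Rabs_le_between in Hu, Hv.
  apply Rle_trans with (Im ((d, L) * u - (d, - L)%R * v)).
  - replace (Im ((d, L) * u - (d, - L)%R * v)) with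
      (d * (Im u - Im v) + L * (Re u + Re v)) by (unfold Re, Im; cbn; ring).
    assert (d * (- (T * (Re u + Re v))) <= d * (Im u - Im v)) by (apply Rmult_le_compat_l; lra).
    assert ((T * d + 1) * (Re u + Re v) <= L * (Re u + Re v)) by (apply Rmult_le_compat_r; lra).
    lra.
  - eapply Rle_trans; [apply Rle_abs|].
    eapply Rle_trans; [apply Rmax_r | apply Rmax_Cmod].
Qed.

Lemma sector_slope_pair_bound (T d L : R) (c p q q' : C) :
  0 < T -> c <> RtoC 0 -> 0 <= d -> T * d + 1 <= L ->
  sector T (c * ((p - q) / (d, L)))%C -> sector T (c * ((p - q') / (d, - L)%R))%C ->
  Cmod (p - q) <= Cmod (d, L) * ((1 + T) * Cmod (q' - q)).
Proof.
  intros HT Hc Hd HL Hu Hv.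
  assert (Hneq : forall y, y <> 0 -> (d, y) <> RtoC 0).
  { intros y Hy Heq. injection Heq. auto. }
  assert (Hpos : 0 < L) by nra.
  set (u := (c * ((p - q) / (d, L)))%C) in *.
  pose proof (sector_pair_bound T d L u _ HT Hd HL Hu Hv) as Hpair.
  assert (Hdiff : ((d, L) * u - (d, - L)%R * (c * ((p - q') / (d, - L)%R)))%C = (c * (q' - q))%C).
  { unfold u. field. split; apply Hneq; lra. }
  rewrite Hdiff, Cmod_mult in Hpair.
  apply Rmult_le_reg_l with (Cmod c); [now apply Cmod_gt_0|].
  rewrite <- Cmod_mult.
  replace (c * (p - q))%C with ((d, L) * u)%C by (unfold u; field; apply Hneq; lra).
  rewrite Cmod_mult.
  pose proof (sector_Cmod T u HT Hu) as Hmod.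
  assert (Hbound : Cmod u <= (1 + T) * (Cmod c * Cmod (q' - q))).
  { apply (Rle_trans _ _ _ Hmod), Rmult_le_compat_l; lra. }
  pose proof (Rmult_le_compat_l _ _ _ (Cmod_ge_0 (d, L)) Hbound). lra.
Qed.

Section Strip.

Variables (F F' : C -> C) (c : C) (s0 s1 T B : R).
Hypothesis T_pos : 0 < T.
Hypothesis c_neq_0 : c <> RtoC 0.
Hypothesis derive_F : forall w, s0 <= Re w < s1 -> is_derive F w (F' w).
Hypothesis sector_F' : forall w, s0 <= Re w < s1 -> sector T (c * F' w)%C.
Hypothesis bounded_on_line : forall w, Re w = s0 -> Cmod (F w - w) <= B.

Lemma strip_sector_slope (a b : C) :
  s0 <= Re a < s1 -> s0 <= Re b < s1 -> a <> b -> sector T (c * ((F b - F a) / (b - a)))%C.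
Proof.
  intros Ha Hb Hneq.
  assert (Hsegment : forall t, 0 <= t <= 1 -> s0 <= Re (a + RtoC t * (b - a)) < s1).
  { intros t Ht. replace (Re (a + RtoC t * (b - a))) with ((1 - t) * Re a + t * Re b)
      by (unfold Re; cbn; ring). destruct (Rle_dec (Re a) (Re b)); nra. }
  apply (sector_slope F F'); auto.
Qed.

Lemma line_increment_bounded (x y : R) :
  Cmod (F (s0, x) - F (s0, y)) <= Rabs (x - y) + 2 * B.
Proof.
  replace (F (s0, x) - F (s0, y))%C with
    ((F (s0, x) - (s0, x)) + ((s0, x) - (s0, y)) + - (F (s0, y) - (s0, y)))%C by ring.
  eapply Rle_trans; [apply Cmod_triangle|]. rewrite Cmod_opp.
  pose proof (Cmod_triangle (F (s0, x) - (s0, x)) ((s0, x) - (s0, y))).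
  pose proof (bounded_on_line (s0, x) eq_refl). pose proof (bounded_on_line (s0, y) eq_refl).
  assert (Hvert : Cmod ((s0, x) - (s0, y)) <= Rabs (x - y)).
  { eapply Rle_trans; [apply Cmod_le_Rabs_plus|]. unfold Re, Im; cbn.
    rewrite Rplus_opp_r, Rabs_R0. right. unfold Rminus. ring. }
  lra.
Qed.

Lemma strip_deviation_bounded :
  exists M, forall w, s0 <= Re w < s1 -> Cmod (F w - w) <= M.
Proof.
  set (width := s1 - s0). set (L := T * width + 1).
  exists ((width + L) * ((1 + T) * (2 * L + 2 * B)) + B + (width + L)). intros w Hw.
  set (d := Re w - s0).
  assert (Hd : 0 <= d <= width) by (unfold d, width; lra).
  assert (HL : T * d + 1 <= L) by (unfold L; nra).
  assert (HL_ge_1 : 1 <= L) by nra.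
  set (lower := (s0, Im w - L) : C). set (upper := (s0, Im w + L) : C).
  assert (Hlower : (w - lower)%C = (d, L)).
  { apply injective_projections; unfold d, lower, Re, Im; cbn; ring. }
  assert (Hupper : (w - upper)%C = (d, - L)).
  { apply injective_projections; unfold d, upper, Re, Im; cbn; ring. }
  assert (Hslope : forall a : C, Re a = s0 -> Im a <> Im w ->
    sector T (c * ((F w - F a) / (w - a)))%C).
  { intros a Ha Him. apply strip_sector_slope; [lra | exact Hw | congruence]. }
  assert (Hcorner : Cmod (d, L) <= width + L).
  { eapply Rle_trans; [apply Cmod_le_Rabs_plus|]. unfold Re, Im; cbn.
    rewrite !Rabs_pos_eq; lra. }
  assert (Hincr : Cmod (F w - F lower) <= (width + L) * ((1 + T) * (2 * L + 2 * B))).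
  { eapply Rle_trans.
    - apply (sector_slope_pair_bound T d L c _ _ (F upper)); try tauto; try lra.
      + rewrite <- Hlower. apply Hslope; cbn; lra.
      + rewrite <- Hupper. apply Hslope; cbn; lra.
    - apply Rmult_le_compat; [apply Cmod_ge_0 | | exact Hcorner |].
      + apply Rmult_le_pos; [lra | apply Cmod_ge_0].
      + apply Rmult_le_compat_l; [lra|]. eapply Rle_trans; [apply line_increment_bounded|].
        replace (Im w + L - (Im w - L)) with (2 * L) by ring. rewrite Rabs_pos_eq; lra. }
  replace (F w - w)%C with ((F w - F lower) + (F lower - lower) + - (w - lower))%C by ring.
  eapply Rle_trans; [apply Cmod_triangle|]. rewrite Cmod_opp, Hlower.
  pose proof (Cmod_triangle (F w - F lower) (F lower - lower)).
  pose proof (bounded_on_line lower eq_refl). lra.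
Qed.

End Strip.

(** * Spirallike functions on the disc *)

Lemma open_in_disc : open (in_disc : C -> Prop).
Proof.
  apply (open_comp Cmod (fun x => x < 1)); [|apply open_lt].
  intros z _. apply continuous_Cmod.
Qed.

Lemma in_disc_0 : in_disc C0.
Proof. change (Cmod 0 < 1). rewrite Cmod_0. exact Rlt_0_1. Qed.

Lemma has_cderiv_is_derive (f : C -> C) (z l : C) :
  in_disc z -> has_cderiv f z l -> is_derive f z l.
Proof.
  intros Hz Hf. apply is_derive_C_iff. intros eps.
  destruct (Hf eps (cond_pos eps)) as [d [Hd Hquot]].
  assert (Hnear : locally z (fun w : C => Cmod (w - z) < d)).
  { exact (proj1 (continuous_Cmod_iff (fun w : C => w) z) (continuous_id z) (mkposreal d Hd)). }
  generalize (filter_and _ _ Hnear (open_in_disc z Hz)). apply filter_imp. intros w [Hwz Hw].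
  destruct (excluded_middle_informative (w = z)) as [->|Hneq].
  - replace (f z - f z - (z - z) * l)%C with (RtoC 0) by ring.
    rewrite Cmod_0. apply Rmult_le_pos; [left; apply cond_pos | apply Cmod_ge_0].
  - pose proof (Cminus_eq_contra w z Hneq) as Hh.
    assert (Hzw : (z + (w - z))%C = w) by ring. rewrite <- Hzw in Hw.
    specialize (Hquot (w - z)%C Hh Hwz Hw).
    change (Cmod ((f (z + (w - z))%C - f z) / (w - z) - l) < eps) in Hquot.
    rewrite Hzw in Hquot.
    replace (f w - f z - (w - z) * l)%C with (((f w - f z) / (w - z) - l) * (w - z))%C
      by (field; exact Hh).
    rewrite Cmod_mult. apply Rmult_le_compat_r; [apply Cmod_ge_0 | lra].
Qed.

Lemma ccontinuous_on_disc_continuous (g : C -> C) :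
  (forall z, in_disc z -> continuous g z) -> ccontinuous_on_disc g.
Proof.
  intros Hg z Hz eps Heps.
  destruct (proj1 (continuous_Cmod_iff g z) (Hg z Hz) (mkposreal eps Heps)) as [d Hd].
  exists d. split; [apply cond_pos|]. intros w _ Hw.
  apply Hd, C_NormedModule_mixin_compat1, Hw.
Qed.

Definition difference_quotient (f : C -> C) (a l z : C) : C :=
  if excluded_middle_informative (z = a) then l else ((f z - f a) / (z - a))%C.

Lemma difference_quotient_eq (f : C -> C) (a l : C) : difference_quotient f a l a = l.
Proof. unfold difference_quotient. destruct (excluded_middle_informative (a = a)); tauto. Qed.

Lemma difference_quotient_neq (f : C -> C) (a l z : C) :
  z <> a -> difference_quotient f a l z = ((f z - f a) / (z - a))%C.
Proof. unfold difference_quotient. destruct (excluded_middle_informative (z = a)); tauto. Qed.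

Lemma continuous_difference_quotient (f : C -> C) (a l : C) :
  is_derive f a l -> continuous (difference_quotient f a l) a.
Proof.
  intros Hf. apply continuous_Cmod_iff. intros eps.
  pose proof (proj1 (is_derive_C_iff f a l) Hf (pos_div_2 eps)) as Hincr.
  revert Hincr. apply filter_imp. intros w Hw. cbn [pos pos_div_2] in Hw.
  pose proof (cond_pos eps) as Heps. rewrite difference_quotient_eq.
  destruct (excluded_middle_informative (w = a)) as [->|Hneq].
  - rewrite difference_quotient_eq. replace (l - l)%C with (RtoC 0) by ring. now rewrite Cmod_0.
  - rewrite difference_quotient_neq by exact Hneq. pose proof (Cminus_eq_contra w a Hneq) as Hwa.
    replace ((f w - f a) / (w - a) - l)%C with ((f w - f a - (w - a) * l) / (w - a))%C
      by (field; exact Hwa).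
    rewrite Cmod_div by exact Hwa. apply Cmod_gt_0 in Hwa.
    apply Rle_lt_trans with (eps / 2); [|lra]. now apply Rle_div_l.
Qed.

Lemma continuous_difference_quotient_neq (f : C -> C) (a l z : C) :
  z <> a -> continuous f z -> continuous (difference_quotient f a l) z.
Proof.
  intros Hneq Hf. pose proof (Cminus_eq_contra z a Hneq) as Hza.
  apply (continuous_ext_loc _ (fun w => ((f w - f a) / (w - a))%C)).
  - assert (Hnear : locally z (fun w : C => Cmod (w - z) < Cmod (z - a))).
    { apply (proj1 (continuous_Cmod_iff (fun w : C => w) z) (continuous_id z)
        (mkposreal _ (proj1 (Cmod_gt_0 _) Hza))). }
    revert Hnear. apply filter_imp. intros w Hw. symmetry. apply difference_quotient_neq.
    intros ->. revert Hw. rewrite <- Cmod_opp. replace (- (a - z))%C with (z - a)%C by ring.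
    apply Rlt_irrefl.
  - apply continuous_Cmult.
    + apply (continuous_minus (V := C_NormedModule)); [exact Hf | apply continuous_const].
    + apply (continuous_comp (fun w => w - a)%C Complex.Cinv); [|now apply continuous_Cinv].
      apply (continuous_minus (V := C_NormedModule)).
      * apply continuous_id.
      * apply continuous_const.
Qed.

Lemma in_disc_scal (t : R) (z : C) :
  0 <= t <= 1 -> in_disc z -> in_disc (scal t (z : C_R_NormedModule)).
Proof.
  intros Ht Hz.
  assert (Hscal : scal t (z : C_R_NormedModule) = (RtoC t * z)%C :> C).
  { apply injective_projections; cbn; unfold mult; cbn; ring. }
  unfold in_disc. rewrite Hscal. change (Cmod (RtoC t * z) < 1). change (Cmod z < 1) in Hz.
  rewrite Cmod_mult, Cmod_R, Rabs_pos_eq by lra. pose proof (Cmod_ge_0 z). nra.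
Qed.

Lemma in_A1_log_quotient (f f' : C -> C) :
  in_A1 f f' -> (forall z, in_disc z -> z <> C0 -> f z <> C0) ->
  exists g : C -> C, g C0 = C0 /\
    forall z, in_disc z -> continuous g z /\ f z = (z * Cexp (g z))%C.
Proof.
  intros [Hf [Hf0 Hf'0]] Hnz.
  assert (Hderive : forall z, in_disc z -> is_derive f z (f' z)).
  { intros z Hz. now apply has_cderiv_is_derive, Hf. }
  assert (Hderive0 : is_derive f C0 (RtoC 1)).
  { change (RtoC 1) with C1. rewrite <- Hf'0. exact (Hderive C0 in_disc_0). }
  set (k := difference_quotient f C0 (RtoC 1)).
  assert (Hk0 : k C0 = RtoC 1) by apply difference_quotient_eq.
  assert (Hk : forall z, z <> C0 -> k z = (f z / z)%C).
  { intros z Hz. unfold k. rewrite difference_quotient_neq, Hf0 by exact Hz.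
    change C0 with (RtoC 0). f_equal; [ring | f_equal; ring]. }
  destruct (continuous_log_star_shaped C_R_NormedModule in_disc k) as [g [Hg0 Hg]].
  - exact open_in_disc.
  - exact in_disc_0.
  - exact in_disc_scal.
  - intros z Hz. destruct (excluded_middle_informative (z = C0)) as [->|Hneq].
    + now apply continuous_difference_quotient.
    + apply continuous_difference_quotient_neq; [exact Hneq|].
      now apply (is_derive_continuous_C f z (f' z)), Hderive.
  - intros z Hz. destruct (excluded_middle_informative (z = C0)) as [->|Hneq].
    + rewrite Hk0. exact C1_nz.
    + rewrite (Hk z Hneq). apply Cdiv_neq_0; [now apply Hnz | exact Hneq].
  - exists g. split.
    + change (g C0 = Clog (k C0)) in Hg0. now rewrite Hg0, Hk0, Clog_1.
    + intros z Hz. destruct (Hg z Hz) as [Hcont ->]. split; [exact Hcont|].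
      destruct (excluded_middle_informative (z = C0)) as [->|Hneq].
      * rewrite Hf0. symmetry. apply Cmult_0_l.
      * rewrite (Hk z Hneq). symmetry. now apply Cmult_Cdiv_cancel.
Qed.

Lemma is_derive_log_coordinate (f g : C -> C) (w l : C) :
  is_derive f (Cexp w) l -> continuous g (Cexp w) ->
  locally (Cexp w : C_UniformSpace) (fun z => f z = (z * Cexp (g z))%C) ->
  is_derive (fun v : C => (v + g (Cexp v))%C) w (Cexp w * l / f (Cexp w))%C.
Proof.
  intros Hf Hg Hfg.
  pose proof (continuous_Cexp w) as Hexp.
  apply (is_derive_log _ (fun v => f (Cexp v))).
  - apply (continuous_plus (V := C_NormedModule)); [apply continuous_id|].
    exact (continuous_comp (Cexp : C -> C) g w Hexp Hg).
  - rewrite Cmult_comm. apply (is_derive_comp_C f Cexp); [exact Hf | apply is_derive_Cexp].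
  - apply (filter_imp (fun v => f (Cexp v) = (Cexp v * Cexp (g (Cexp v)))%C)).
    + intros v ->. apply Cexp_plus.
    + exact (Hexp _ Hfg).
Qed.

Lemma in_disc_Cexp (w : C) : Re w < 0 -> in_disc (Cexp w).
Proof.
  intros Hw. change (Cmod (Cexp w) < 1). rewrite Cmod_Cexp, <- exp_0. now apply exp_increasing.
Qed.

Lemma continuous_bounded_near_0 (g : C -> C) :
  continuous g C0 -> exists s0 B : R, forall z, Cmod z <= exp s0 -> Cmod (g z) <= B.
Proof.
  intros Hg.
  destruct (proj1 (continuous_Cmod_iff g C0) Hg (mkposreal 1 Rlt_0_1)) as [d Hd].
  pose proof (cond_pos d) as Hpos.
  exists (ln (d / 2)), (Cmod (g C0) + 1). rewrite exp_ln by lra. intros z Hz.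
  assert (Hball : ball (C0 : C_UniformSpace) d z).
  { apply C_NormedModule_mixin_compat1. change (Cmod (z - 0) < d).
    replace (z - 0)%C with z by ring. lra. }
  specialize (Hd z Hball). cbn [pos] in Hd.
  replace (g z) with (g C0 + (g z - g C0))%C by ring.
  eapply Rle_trans; [apply Cmod_triangle | lra].
Qed.

Lemma bounded_on_disc_of_strip (g : C -> C) (s0 B M : R) :
  (forall z, Cmod z <= exp s0 -> Cmod (g z) <= B) ->
  (forall w, s0 <= Re w < 0 -> Cmod (g (Cexp w)) <= M) ->
  forall z, in_disc z -> Cmod (g z) <= Rmax B M.
Proof.
  intros Hnear Hstrip z Hz. change (Cmod z < 1) in Hz.
  destruct (Rle_lt_dec (Cmod z) (exp s0)) as [Hle|Hlt].
  - eapply Rle_trans; [now apply Hnear | apply Rmax_l].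
  - eapply Rle_trans; [|apply Rmax_r].
    assert (Hpos : 0 < Cmod z) by (pose proof (exp_pos s0); lra).
    rewrite <- (Cexp_Clog z) by now apply Cmod_gt_0.
    apply Hstrip. cbn. split.
    + left. rewrite <- (ln_exp s0). apply ln_increasing; [apply exp_pos | exact Hlt].
    + rewrite <- ln_1. now apply ln_increasing.
Qed.

Lemma strongly_spirallike_log_bounded (f f' g : C -> C) (lambda alpha : R) :
  0 < alpha < 1 -> (forall z, in_disc z -> is_derive f z (f' z)) ->
  strongly_spirallike f f' lambda alpha ->
  (forall z, in_disc z -> continuous g z /\ f z = (z * Cexp (g z))%C) ->
  exists M, forall z, in_disc z -> Cmod (g z) <= M.
Proof.
  intros Halpha Hf Hspiral Hg. pose proof PI_RGT_0 as Hpi.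
  assert (Hbeta : 0 < PI * alpha / 2 < PI / 2) by nra.
  assert (Hcancel : forall w, (w + g (Cexp w) - w)%C = g (Cexp w)) by (intros; ring).
  destruct (continuous_bounded_near_0 g) as [s0 [B Hnear]].
  { apply Hg, in_disc_0. }
  destruct (strip_deviation_bounded (fun w => w + g (Cexp w))%C
    (fun w => Cexp w * f' (Cexp w) / f (Cexp w))%C (Cexp (0, - lambda)) s0 0
    (tan (PI * alpha / 2)) B) as [M HM].
  - apply tan_gt_0; lra.
  - apply Cexp_neq_0.
  - intros w [_ Hw]. apply in_disc_Cexp in Hw. apply is_derive_log_coordinate.
    + now apply Hf.
    + now apply Hg.
    + generalize (open_in_disc _ Hw). apply filter_imp. intros z Hz. now apply Hg.
  - intros w [_ Hw]. apply sector_tan_Arg; [exact Hbeta|].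
    apply (Hspiral (Cexp w)); [now apply in_disc_Cexp | apply Cexp_neq_0].
  - intros w Hw. rewrite Hcancel. apply Hnear. rewrite Cmod_Cexp, Hw. apply Rle_refl.
  - exists (Rmax B M). apply (bounded_on_disc_of_strip g s0 B M Hnear).
    intros w Hw. rewrite <- Hcancel. now apply HM.
Qed.

Lemma Cmod_Cmult_Cexp_le (z w : C) (M : R) :
  Cmod z <= 1 -> Cmod w <= M -> Cmod (z * Cexp w) <= exp M.
Proof.
  intros Hz Hw. rewrite Cmod_mult, Cmod_Cexp.
  assert (Hexp : exp (Re w) <= exp M).
  { apply Rnot_lt_le. intros Hlt%exp_lt_inv.
    pose proof (re_le_Cmod w). pose proof (Rle_abs (Re w)). lra. }
  pose proof (exp_pos (Re w)). pose proof (Cmod_ge_0 z). nra.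
Qed.

Theorem theorem2 (f f' : Cplx -> Cplx) :
  in_A1 f f' ->
  (exists lambda alpha : R,
      - (PI / 2) < lambda < PI / 2 /\ 0 < alpha < 1 /\
      strongly_spirallike f f' lambda alpha) ->
  (exists g : Cplx -> Cplx,
      ccontinuous_on_disc g /\ g C0 = C0 /\
      (forall z : Cplx, in_disc z -> z <> C0 -> Cexp (g z) = Cdiv (f z) z) /\
      (exists M : R, forall z : Cplx, in_disc z -> Cnorm (g z) <= M)) /\
  (exists M : R, forall z : Cplx, in_disc z -> Cnorm (f z) <= M).
Proof.
  intros Hf [lambda [alpha [_ [Halpha Hspiral]]]].
  destruct (in_A1_log_quotient f f' Hf) as [g [Hg0 Hg]].
  { intros z Hz Hz0. now apply Hspiral. }
  destruct (strongly_spirallike_log_bounded f f' g lambda alpha) as [M HM]; auto.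
  { intros z Hz. now apply has_cderiv_is_derive, Hf. }
  split.
  - exists g. repeat split.
    + apply ccontinuous_on_disc_continuous. intros z Hz. now apply Hg.
    + exact Hg0.
    + intros z Hz Hz0. destruct (Hg z Hz) as [_ ->]. symmetry. now apply Cdiv_Cmult_cancel.
    + exists M. exact HM.
  - exists (exp M). intros z Hz. destruct (Hg z Hz) as [_ ->].
    apply Cmod_Cmult_Cexp_le; [now left | now apply HM].
Qed.
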